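(* Let $A$ be a Dedekind domain (not a field). Then for every non-negative integer $n$ there exists an $n$-universal set $E_n\subset A$ with $n+2$ elements. In fact, there exists an increasing family $E_0\subset E_1\subset E_2\subset\ldots$ of subsets of $A$ such that, for every $n\geq 0$, $E_n$ is an $n$-universal set in $A$ with $n+2$ elements.
   Context: For a domain $A$ with field of fractions $K$, a finite subset $S\subset A$ is called $n$-universal if for every polynomial $P\in K[X]$ of degree at most $n$ one has $P(A)\subset A$ if and only if $P(S)\subset A$. *)

(* Defs.v *)
From mathcomp Require Import all_boot all_order all_algebra.
From mathcomp Require Import finmap.

Set Implicit Arguments.
Unset Strict Implicit.
Unset Printing Implicit Defensive.

Import GRing.Theory.
Local Open Scope ring_scope.

(* [idealr_closed I] says that I is a *proper* ideal (it includes 1 \notin I).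
   Subsets of a ring are boolean predicates; with classical logic and choice
   this covers all subsets. *)

Definition generates (A : comNzRingType) (s : seq A) (I : {pred A}) : Prop :=
  forall x : A,
    x \in I <-> exists c : 'I_(size s) -> A, x = \sum_(i < size s) c i * s`_i.

(* The unit ideal is generated by 1, so proper ideals suffice. *)
Definition noetherian (A : comNzRingType) : Prop :=
  forall I : {pred A}, idealr_closed I -> exists s : seq A, generates s I.

Definition prime_ideal (A : comNzRingType) (I : {pred A}) : Prop :=
  idealr_closed I /\ prime_idealr_closed I.

Definition maximal_ideal (A : comNzRingType) (I : {pred A}) : Prop :=
  idealr_closed I /\
  forall J : {pred A}, idealr_closed J -> {subset I <= J} -> J =i I.

Definition integrally_closed (A : idomainType) : Prop :=
  forall x : {fraction A},
    integralOver (@tofrac A) x -> exists a : A, x = tofrac a.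

Definition is_field (A : idomainType) : Prop :=
  forall x : A, x != 0 -> x \is a GRing.unit.

(* Fields are Dedekind domains under this definition. *)
Definition dedekind (A : idomainType) : Prop :=
  [/\ noetherian A,
      integrally_closed A
    & forall I : {pred A},
        prime_ideal I -> (exists2 x : A, x \in I & x != 0) -> maximal_ideal I].

Definition maps_into_ring (A : idomainType) (P : {poly {fraction A}})
    (S : {pred A}) : Prop :=
  forall a : A, a \in S -> exists b : A, P.[tofrac a] = tofrac b.

(* Degree at most n is [size P <= n.+1]; the zero polynomial is included. *)
Definition universal (A : idomainType) (n : nat) (S : {fset A}) : Prop :=
  forall P : {poly {fraction A}}, (size P <= n.+1)%N ->
    (maps_into_ring P predT <-> maps_into_ring P (mem S)).

(* Main.v *)
Require Import Defs.
From mathcomp Require Import all_boot all_order all_algebra.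
From mathcomp Require Import finmap.
From mathcomp Require Import boolp ring.

Set Implicit Arguments.
Unset Strict Implicit.
Unset Printing Implicit Defensive.

(** Universality is a local question, answered by Bhargava's p-orderings.  Fix
a nonzero prime ideal p and write b |_p c when b divides c in the localization
at p.  A p-ordering is a sequence in which each element x minimizes, for |_p
and over the whole ring, the product of the differences (x - a) with its
predecessors a.

A p-ordering of n + 1 elements tests integrality at p of every P of degree at
most n ([p_ordering_interpolation]): in the Newton form of P the coefficients
are determined one after the other by the values at the nodes, and minimality
says precisely that each term takes p-integral values everywhere.  Since an
element of the fraction field that is integral at every nonzero prime lies in
the ring ([integral_of_locally]), a set is n-universal as soon as it contains
a p-ordering of length n + 1 for every p ([locally_rich_universal]).

The p-orderings for different p need not come from the same n + 1 elements;
but one spare element is enough, and keeps being enough.  Let E have n + 2 elements and contain a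
p-ordering of length n + 1 for every p ([locally_rich_extend]).  If p divides
no difference of elements of E, then all of E, in any order, is a p-ordering,
of length n + 2.  Only finitely many p are left ([finite_primes_above]); for
each of them, the p-ordering inside E has a best continuation x_p
([p_ordering_next]), and any x close enough p-adically to x_p is just as good
([approximate_next]).  The Chinese remainder theorem
([simultaneous_approximation]) gives a single x close to all the x_p, and
adjoining it to E yields p-orderings of length n + 2 for all p.

The Dedekind hypothesis enters through three facts: the localization at p is a
valuation ring ([ldvd_total]), so that minimal products exist; a nonzero
element lies in finitely many primes; and local conditions at distinct primes
are independent ([local_comaximal]).  Not being a field makes the ring
infinite, which leaves room for new elements. *)

Import GRing.Theory.
Local Open Scope ring_scope.

(** * Ideals of Noetherian and Dedekind domains *)

Section Ideals.
Variable A : idomainType.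
Implicit Types (I J p q : A -> Prop).

(** Unlike [idealr_closed], this admits the unit ideal, so that sums of ideals
are ideals without a side condition. *)
Definition ideal I := I 0 /\ forall a u v, I u -> I v -> I (a * u + v).

Definition subideal I J := forall x, I x -> J x.

Definition nzprime p :=
  [/\ ideal p, ~ p 1, forall u v, p (u * v) -> p u \/ p v
    & exists2 x, p x & x != 0].

Lemma idealM I a u : ideal I -> I u -> I (a * u).
Proof. by move=> [I0 hI] Iu; rewrite -[a * u]addr0; apply: hI. Qed.

Lemma idealD I u v : ideal I -> I u -> I v -> I (u + v).
Proof. by move=> [I0 hI] Iu Iv; rewrite -[u]mul1r; apply: hI. Qed.

Lemma idealB I u v : ideal I -> I u -> I v -> I (u - v).
Proof. by move=> hI Iu Iv; rewrite addrC -mulN1r; apply: hI.2. Qed.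

Lemma ideal_sum I (n : nat) (F : 'I_n -> A) :
  ideal I -> (forall i, I (F i)) -> I (\sum_i F i).
Proof.
move=> hI hF; elim/big_ind: _ => //; first exact: hI.1.
by move=> u v; apply: idealD.
Qed.

Definition adjoin I x : A -> Prop := fun z => exists a u, I u /\ z = a * x + u.

Lemma adjoin_ideal I x : ideal I -> ideal (adjoin I x).
Proof.
move=> hI; split; first by exists 0, 0; split; [exact: hI.1 | ring].
move=> a _ _ [b [u [Iu ->]]] [c [v [Iv ->]]].
by exists (a * b + c), (a * u + v); split; [exact: hI.2 | ring].
Qed.

Lemma adjoin_sub I x : subideal I (adjoin I x).
Proof. by move=> u Iu; exists 0, u; split; [|ring]. Qed.

Lemma adjoin_mem I x : ideal I -> adjoin I x x.
Proof. by move=> hI; exists 1, 0; split; [exact: hI.1|ring]. Qed.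

Lemma sub_adjoin I J x : ideal J -> subideal I J -> J x -> subideal (adjoin I x) J.
Proof. by move=> hJ sIJ Jx _ [a [u [Iu ->]]]; apply: hJ.2 => //; apply: sIJ. Qed.

Lemma ideal_closed_asbool I :
  ideal I -> ~ I 1 -> idealr_closed (fun x => `[< I x >] : bool).
Proof.
move=> [I0 hI] I1; split; first exact/asboolP.
- exact/asboolPn.
- by move=> a u v /asboolP Iu /asboolP Iv; apply/asboolP; apply: hI.
Qed.

Lemma ideal_fg I : noetherian A -> ideal I ->
  exists s : seq A, forall x,
    I x <-> exists c : 'I_(size s) -> A, x = \sum_(i < size s) c i * s`_i.
Proof.
move=> hN hI; have [I1|I1] := lem (I 1).
  exists [:: 1] => x; split=> _; last by rewrite -[x]mulr1; apply: idealM.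
  by exists (fun=> x); rewrite big_ord1 mulr1.
have [s hs] := hN _ (ideal_closed_asbool hI I1).
exists s => x; rewrite -hs; split; first by move=> Ix; apply/asboolP.
by move/asboolP.
Qed.

Lemma ideal_fg_mem I (s : seq A) :
  (forall x, I x <-> exists c : 'I_(size s) -> A,
      x = \sum_(i < size s) c i * s`_i) ->
  forall i : 'I_(size s), I s`_i.
Proof.
move=> hs i; apply/hs; exists (fun j => (j == i)%:R).
rewrite (bigD1 i) //= eqxx mul1r big1 ?addr0 // => j /negbTE ->.
by rewrite mul0r.
Qed.

(** A failure at one ideal could be pushed forever to strictly larger ideals;
the union of the resulting chain is generated by finitely many elements, which
already lie in one term of the chain. *)
Lemma noether_ind (P : (A -> Prop) -> Prop) : noetherian A ->
  (forall I, ideal I ->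
     (forall J, ideal J -> subideal I J -> ~ subideal J I -> P J) -> P I) ->
  forall I, ideal I -> P I.
Proof.
move=> hN step I0 hI0; apply: contrapT => nP0.
pose T := {I | ideal I /\ ~ P I}.
have next (X : T) : exists Y : T,
    subideal (sval X) (sval Y) /\ ~ subideal (sval Y) (sval X).
  case: X => I [hI nP] /=; apply: contrapT => nY; apply: nP; apply: step => //.
  move=> J hJ sIJ nJI; apply: contrapT => nPJ; apply: nY.
  by exists (exist _ J (conj hJ nPJ)).
have [f hf] := choice next.
pose chain n := sval (iter n f (exist _ I0 (conj hI0 nP0))).
have chainI n : ideal (chain n) by exact: (svalP (iter n f _)).1.
have chain_le m n : (m <= n)%N -> subideal (chain m) (chain n).
  elim: n => [|n IHn]; first by rewrite leqn0 => /eqP ->.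
  rewrite leq_eqVlt => /orP[/eqP -> //|]; rewrite ltnS => /IHn h x /h.
  exact: (hf _).1.
pose U x := exists n, chain n x.
have hU : ideal U.
  split; first by exists 0; apply: (chainI 0%N).1.
  move=> a u v [m hm] [n hn]; exists (maxn m n); apply: (chainI _).2.
    by apply: chain_le hm; apply: leq_maxl.
  by apply: chain_le hn; apply: leq_maxr.
have [s hs] := ideal_fg hN hU.
have [g hg] := choice (ideal_fg_mem hs).
pose N := \max_i g i.
apply: (hf (iter N f (exist _ I0 (conj hI0 nP0)))).2 => x hx.
have /hs [c ->] : U x by exists N.+1.
apply: ideal_sum => [|i]; first exact: (chainI N).
apply: idealM; first exact: (chainI N).
by apply: chain_le (hg i); apply: leq_bigmax.
Qed.

Lemma noether_max T (F : T -> A -> Prop) (Q : T -> Prop) : noetherian A ->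
  (forall x, ideal (F x)) -> (exists x, Q x) ->
  exists x, Q x /\
    forall y, Q y -> subideal (F x) (F y) -> subideal (F y) (F x).
Proof.
move=> hN hF [x0 Qx0]; apply: contrapT => nmax.
suff: forall I, ideal I -> forall x, F x = I -> ~ Q x by move/(_ _ (hF x0) x0 erefl).
apply: noether_ind => // I _ IH x eI Qx; subst I.
apply: nmax; exists x; split=> // y Qy sxy; apply: contrapT => nyx.
exact: (IH _ (hF y) sxy nyx y erefl).
Qed.

(** An ideal maximal among those disjoint from the multiplicative set S is
prime: enlarging it by either factor of a product it contains produces an
element of S, and the product of these two elements of S falls back into the
ideal.  The case S = {1} gives maximal ideals. *)
Lemma prime_avoiding (S I : A -> Prop) : noetherian A ->
  (forall s t, S s -> S t -> S (s * t)) ->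
  ideal I -> (forall x, I x -> ~ S x) ->
  exists p, [/\ ideal p, subideal I p, forall x, p x -> ~ S x
    & forall u v, p (u * v) -> p u \/ p v].
Proof.
move=> hN hS; move: I; apply: noether_ind => // I hI IH IS.
have [[u [v [Iuv Iu Iv]]]|nuv] :=
    lem (exists u v, [/\ I (u * v), ~ I u & ~ I v]); last first.
  exists I; split=> // u v Iuv; apply: contrapT => /not_orP[Iu Iv].
  by apply: nuv; exists u, v.
have grow w : ~ I w -> (forall x, adjoin I w x -> ~ S x) ->
    exists p, [/\ ideal p, subideal I p, forall x, p x -> ~ S x
      & forall u v, p (u * v) -> p u \/ p v].
  move=> Iw dis.
  have [|p [hp sp dp pp]] := IH _ (adjoin_ideal w hI) (@adjoin_sub I w) _ dis.
    by move/(_ w (adjoin_mem w hI)).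
  by exists p; split=> // x /(@adjoin_sub I w)/sp.
have [du|/existsNP[x /not_implyP[[a [i [Ii ->]]] /contrapT Sx]]] :=
  lem (forall x, adjoin I u x -> ~ S x); first exact: grow Iu du.
have [dv|/existsNP[y /not_implyP[[b [j [Ij ->]]] /contrapT Sy]]] :=
  lem (forall x, adjoin I v x -> ~ S x); first exact: grow Iv dv.
case: (IS _ _ (hS _ _ Sx Sy)).
have -> : (a * u + i) * (b * v + j) =
  (a * b) * (u * v) + ((a * u) * j + (b * v + j) * i) by ring.
by apply: hI.2 => //; apply: hI.2 => //; apply: idealM.
Qed.

Lemma nzprimeNM p s t : nzprime p -> ~ p s -> ~ p t -> ~ p (s * t).
Proof. by case=> _ _ pp _ ps pt /pp []. Qed.

Lemma nzprime_maximal p J : dedekind A ->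
  nzprime p -> ideal J -> ~ J 1 -> subideal p J -> J = p.
Proof.
move=> [_ _ hdim] [hp p1 pp [x px x0]] hJ J1 sJ.
have [||_ hmax] := hdim (fun x => `[< p x >] : bool).
- split; first exact: ideal_closed_asbool.
  by move=> u v /asboolP/pp[] /asboolP h; apply/orP; [left|right].
- by exists x => //; apply/asboolP.
have h := hmax (fun x => `[< J x >] : bool) (ideal_closed_asbool hJ J1)
  (fun z pz => asboolT (sJ z (asboolW pz))).
apply/predeqP => y; split; last exact: sJ.
by move=> Jy; apply: asboolW (etrans (esym (h y)) (asboolT Jy)).
Qed.

Lemma nzprime_above I : dedekind A -> ideal I -> ~ I 1 ->
  (exists2 x, I x & x != 0) -> exists2 p, nzprime p & subideal I p.
Proof.
move=> [hN _ _] hI I1 [x Ix x0].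
have [|||p [hp sp p1 pp]] := @prime_avoiding (fun x => x = 1) I hN => //.
- by move=> _ _ -> ->; rewrite mulr1.
- by move=> y Iy y1; apply: I1; rewrite -y1.
exists p => //; split=> //; first by move/p1.
by exists x => //; apply: sp.
Qed.

(** Noetherian induction: a prime ideal is maximal, hence is the only prime
above itself; if I contains u * v but neither factor, then every prime above I
lies above I + (u) or above I + (v). *)
Lemma finite_primes_above I : dedekind A -> ideal I ->
  (exists2 x, I x & x != 0) ->
  exists L : seq (A -> Prop), forall p, nzprime p -> subideal I p -> p \in L.
Proof.
move=> hA; have [hN _ _] := hA; move: I; apply: noether_ind => // I hI IH [x Ix x0].
have [I1|I1] := lem (I 1).
  by exists [::] => p [_ p1 _ _] sIp; case: p1; apply: sIp.
have [[u [v [Iuv Iu Iv]]]|nuv] :=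
    lem (exists u v, [/\ I (u * v), ~ I u & ~ I v]); last first.
  exists [:: I] => p hp sIp; rewrite inE; apply/eqP.
  apply: (nzprime_maximal hA) sIp; try by case: hp.
  split=> //; last by exists x.
  move=> u v Iuv; apply: contrapT => /not_orP[Iu Iv].
  by apply: nuv; exists u, v.
have above w : ~ I w -> exists L : seq (A -> Prop),
    forall p, nzprime p -> subideal I p -> p w -> p \in L.
  move=> Iw.
  have [||L hL] := IH (adjoin I w) (adjoin_ideal w hI) (@adjoin_sub I w).
  - by move/(_ w (adjoin_mem w hI)).
  - by exists x => //; apply: adjoin_sub.
  exists L => p hp sIp pw; apply: hL => //; apply: sub_adjoin => //.
  by case: hp.
have [[L1 h1] [L2 h2]] := (above _ Iu, above _ Iv).
exists (L1 ++ L2) => p hp sIp; rewrite mem_cat; have [_ _ pp _] := hp.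
by case/pp: (sIp _ Iuv) => [/h1-> //|/h2-> //]; rewrite orbT.
Qed.

End Ideals.

(** * Localization at a nonzero prime is a valuation ring *)

Section Localization.
Variable A : idomainType.
Implicit Types (I J p q : A -> Prop) (b c : A).

(** Divisibility of c by b in the localization at p, after clearing
denominators. *)
Definition ldvd p b c := exists s w, ~ p s /\ s * c = w * b.

Lemma ldvd_refl p b : nzprime p -> ldvd p b b.
Proof. by case=> _ p1 _ _; exists 1, 1. Qed.

Lemma ldvd_trans p b c d : nzprime p -> ldvd p b c -> ldvd p c d -> ldvd p b d.
Proof.
move=> hp [s [w [ps e]]] [t [v [pt f]]].
exists (s * t), (v * w); split; first exact: nzprimeNM.
by rewrite -mulrA f mulrCA e mulrA.
Qed.

Lemma ldvd_unit p b c : ~ p b -> ldvd p b c.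
Proof. by exists b, c; split; rewrite // mulrC. Qed.

Lemma ldvd_ideal p b : nzprime p -> ideal (ldvd p b).
Proof.
move=> hp; have [_ p1 _ _] := hp.
split; first by exists 1, 0; split; rewrite // mulr0 mul0r.
move=> a u v [s [w [ps e]]] [t [x [pt f]]].
exists (s * t), (a * t * w + s * x); split; first exact: nzprimeNM.
rewrite [RHS]mulrDl -!mulrA -e -f; ring.
Qed.

Lemma ldvdM p b c d e : nzprime p ->
  ldvd p b c -> ldvd p d e -> ldvd p (b * d) (c * e).
Proof.
move=> hp [s [w [ps h]]] [t [x [pt k]]].
exists (s * t), (w * x); split; first exact: nzprimeNM.
by rewrite mulrACA h k mulrACA.
Qed.

(** The determinant trick: x is an eigenvalue of M, hence a root of its monic
characteristic polynomial. *)
Lemma integral_of_matrix n (g : 'rV[A]_n) (M : 'M[A]_n) (x : {fraction A}) :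
  g != 0 ->
  map_mx (@tofrac A) g *m map_mx (@tofrac A) M = x *: map_mx (@tofrac A) g ->
  integralOver (@tofrac A) x.
Proof.
move=> g0 gM; exists (char_poly M); first exact: char_poly_monic.
rewrite map_char_poly -eigenvalue_root_char.
apply/eigenvalueP; exists (map_mx (@tofrac A) g) => //.
apply: contraNneq g0 => /rowP g0; apply/eqP/rowP => i.
by have /eqP := g0 i; rewrite !mxE tofrac_eq0 => /eqP.
Qed.

(** Multiplication by u / c maps the finitely generated ideal I to itself, so
u / c is integral over A, and A is integrally closed. *)
Lemma stable_ideal_quotient I u c : dedekind A -> ideal I ->
  (exists2 x, I x & x != 0) -> c != 0 ->
  (forall y, I y -> exists2 w, I w & y * u = w * c) ->
  exists a, u = a * c.
Proof.
move=> [hN hic _] hI [x Ix x0] c0 hu.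
have [s hs] := ideal_fg hN hI.
have col (i : 'I_(size s)) : exists C : 'I_(size s) -> A,
    s`_i * u = (\sum_j C j * s`_j) * c.
  by have [w /hs [C ->] e] := hu _ (ideal_fg_mem hs i); exists C.
have [C hC] := choice col.
have c0F : tofrac c != 0 by rewrite tofrac_eq0.
have [|a ha] := hic (tofrac u / tofrac c); last first.
  exists a; apply/eqP; rewrite -tofrac_eq tofracM -ha.
  by rewrite mulfVK.
apply: (@integral_of_matrix _ (\row_i s`_i) (\matrix_(j, i) C i j)).
  apply: contraNneq x0 => /rowP s0; have /hs [d ->] := Ix.
  rewrite big1 // => i _; have := s0 i; rewrite !mxE => ->.
  by rewrite mulr0.
apply/rowP => i; rewrite !mxE; apply: (mulIf c0F).
rewrite mulrAC mulfVK // -!tofracM [u * _]mulrC hC tofracM; congr (_ * _).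
rewrite rmorph_sum /=; apply: eq_bigr => j _.
by rewrite !mxE tofracM mulrC.
Qed.

(** Among the ideals (c : z) with z not locally divisible by c, a maximal one is
prime, hence equals p: so x = z / c is not in the localization but multiplies p
into it.  If some t in p has x * t a local unit, then t generates p locally.
Otherwise x multiplies p into p locally; as p is finitely generated, one
denominator s outside p serves for all of p, and [stable_ideal_quotient] puts
s * x in A, a contradiction. *)
Lemma uniformizer p : dedekind A -> nzprime p ->
  exists2 t, p t & forall y, p y -> ldvd p t y.
Proof.
move=> hA hp; have [hN _ _] := hA; have [ip p1 pp [c pc c0]] := hp.
pose F z y := ldvd p c (y * z).
have hF z : ideal (F z).
  have [h0 hD] := ldvd_ideal c hp.
  split; first by rewrite /F mul0r.
  by move=> a u v hu hv; rewrite /F mulrDl -mulrA; apply: hD.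
have [z [cz zmax]] : exists z, ~ ldvd p c z /\
    forall y, ~ ldvd p c y -> subideal (F z) (F y) -> subideal (F y) (F z).
  apply: noether_max => //; exists 1 => -[s [w [ps e]]]; apply: ps.
  by move: e; rewrite mulr1 => ->; apply: idealM.
have Fzp : p = F z.
  have Fc : F z c by exists 1, z; split; rewrite // mul1r mulrC.
  have Fp : nzprime (F z).
    split=> //; [by rewrite /F mul1r| |by exists c].
    move=> u v huv; apply: contrapT => /not_orP[hu hv]; apply: hv.
    apply: (zmax (u * z)) => // [y hy|].
      by rewrite /F mulrCA; apply: idealM => //; apply: ldvd_ideal.
    by rewrite /F mulrCA mulrA.
  apply: (nzprime_maximal hA Fp ip p1) => y [s [w [ps e]]].
  apply: contrapT => py; apply: cz; exists (s * y), w.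
  by split; [exact: nzprimeNM | rewrite -mulrA].
have [[t [s [w [pt ps pw e]]]]|none] :=
    lem (exists t s w, [/\ p t, ~ p s, ~ p w & s * (t * z) = w * c]).
  exists t => // y; rewrite {1}Fzp => -[r [x [pr f]]].
  exists (r * w), (x * s); split; first exact: nzprimeNM.
  apply: (mulIf c0).
  have -> : r * w * y * c = r * y * (w * c) by ring.
  rewrite -e.
  have -> : r * y * (s * (t * z)) = r * (y * z) * (s * t) by ring.
  by rewrite f; ring.
have [s [ps hs]] : exists s, ~ p s /\
    forall y, p y -> exists w, y * (s * z) = w * c.
  have [l hl] := ideal_fg hN ip.
  (* A common denominator on generators, accumulated along the list. *)
  have [s [ps hs]] : exists s, ~ p s /\
      forall i : 'I_(size l), exists w, l`_i * (s * z) = w * c.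
    have : forall y, y \in l -> p y.
      move=> y /(nthP 0)[i hi <-].
      exact: (ideal_fg_mem hl (Ordinal hi)).
    suff sl : forall l' : seq A, (forall y, y \in l' -> p y) ->
        exists s, ~ p s /\ forall y, y \in l' -> exists w, y * (s * z) = w * c.
      move/sl=> [s [ps hs]]; exists s; split=> // i; apply: hs.
      exact: mem_nth.
    elim=> [|y l' IH] hl'; first by exists 1.
    have [|s [ps hs]] := IH; first by move=> x hx; apply: hl'; rewrite inE hx orbT.
    have [t [w [pt e]]] : F z y by rewrite -Fzp; apply: hl'; rewrite mem_head.
    exists (s * t); split; first exact: nzprimeNM.
    move=> x; rewrite inE => /orP[/eqP ->|/hs[v f]].
      exists (s * w); rewrite -[RHS]mulrA -e; ring.
    exists (t * v); rewrite -[RHS]mulrA -f; ring.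
  exists s; split=> // y /hl [C ->].
  have [w hw] := choice hs.
  exists (\sum_i C i * w i); rewrite !mulr_suml; apply: eq_bigr => i _.
  by rewrite -mulrA hw mulrA.
have [||||a ha] := @stable_ideal_quotient p (s * z) c hA => //.
- by exists c.
- move=> y py; have [w hw] := hs y py; exists w => //.
  apply: contrapT => pw; apply: none; exists y, s, w; split=> //.
  by rewrite mulrCA.
by case: cz; exists s, a.
Qed.

(** If both elements lie in p, divide both by a uniformizer; this strictly
enlarges the ideal of local multiples of the first one, so that the division
stops by Noetherian induction. *)
Lemma ldvd_total p b c : dedekind A -> nzprime p -> ldvd p b c \/ ldvd p c b.
Proof.
move=> hA hp; have [hN _ _] := hA; have [ip p1 pp _] := hp.
have [t pt ht] := uniformizer hA hp.
have [->|] := eqVneq b 0; first by right; exists 1, 0; split; rewrite // mulr0 mul0r.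
suff : forall I, ideal I -> forall b, I = ldvd p b -> b != 0 ->
    forall c, ldvd p b c \/ ldvd p c b.
  by move/(_ _ (ldvd_ideal b hp) b erefl) => h b0; apply: h.
apply: noether_ind => // I _ IH {b c} b eI b0 c; subst I.
have [pb|pb] := lem (p b); last by left; apply: ldvd_unit.
have [pc|pc] := lem (p c); last by right; apply: ldvd_unit.
have [s [b' [ps eb]]] := ht b pb; have [r [c' [pr ec]]] := ht c pc.
have b'0 : b' != 0.
  apply: contraNneq b0 => b'0; apply: contrapT => b0.
  have : s * b != 0; last by rewrite eb b'0 mul0r eqxx.
  rewrite mulf_neq0 //; last exact/negP.
  by apply: contra_notN ps => /eqP ->; case: ip.
have sb : ldvd p b' b by exists s, t; split; rewrite // eb mulrC.
have sb' : ldvd p b (b' * t) by exists 1, s; split; rewrite // mul1r eb.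
have scl : ldvd p c (c' * t) by exists 1, r; split; rewrite // mul1r ec.
have scr : ldvd p (c' * t) c by exists r, 1; split; rewrite // mul1r ec.
have sbr : ldvd p (b' * t) b by exists s, 1; split; rewrite // mul1r eb.
have [|nb|h|h] := IH _ (ldvd_ideal b' hp) _ _ b' erefl b'0 c'.
- by move=> x; apply: ldvd_trans.
- have [w [v [pw e]]] := nb _ (ldvd_refl b' hp).
  case: (nzprimeNM hp ps pw); suff -> : s * w = v * t by apply: idealM.
  apply: (mulIf b'0); rewrite -mulrA e mulrCA eb; ring.
- left; apply: ldvd_trans (sb') _ => //; apply: ldvd_trans scr => //.
  by apply: ldvdM => //; apply: ldvd_refl.
- right; apply: ldvd_trans (scl) _ => //; apply: ldvd_trans sbr => //.
  by apply: ldvdM => //; apply: ldvd_refl.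
Qed.

End Localization.

(** * Integrality is a local property *)

Section LocalIntegrality.
Variable A : idomainType.
Implicit Types (p q : A -> Prop) (x y : {fraction A}).

Definition locally_integral p x :=
  exists s b, ~ p s /\ tofrac s * x = tofrac b.

Lemma locally_integralB p x y : nzprime p ->
  locally_integral p x -> locally_integral p y -> locally_integral p (x - y).
Proof.
move=> hp [s [b [ps e]]] [t [c [pt f]]].
exists (s * t), (t * b - s * c); split; first exact: nzprimeNM.
by rewrite tofracB !tofracM -e -f; ring.
Qed.

Lemma locally_integralD p x y : nzprime p ->
  locally_integral p x -> locally_integral p y -> locally_integral p (x + y).
Proof.
move=> hp [s [b [ps e]]] [t [c [pt f]]].
exists (s * t), (t * b + s * c); split; first exact: nzprimeNM.
by rewrite tofracD !tofracM -e -f; ring.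
Qed.

Lemma locally_integral_ldvd p x (b c : A) : nzprime p -> ldvd p b c ->
  locally_integral p (x * tofrac b) -> locally_integral p (x * tofrac c).
Proof.
move=> hp [s [w [ps e]]] [t [v [pt f]]].
exists (s * t), (w * v); split; first exact: nzprimeNM.
rewrite [RHS]tofracM -f.
have -> : tofrac w * (tofrac t * (x * tofrac b)) =
  tofrac t * x * tofrac (w * b) by rewrite tofracM; ring.
by rewrite -e !tofracM; ring.
Qed.

Lemma fraction_denominator x : exists2 d : A, d != 0 &
  exists b : A, tofrac d * x = tofrac b.
Proof.
exists \d_(repr x); first exact: denom_ratioP.
exists \n_(repr x).
rewrite -[in LHS](reprK x); unlock FracField.tofrac.
rewrite -[LHS]FracField.pi_mul; apply/eqmodP/eqP => /=.
by rewrite /FracField.mulf /= !numden_Ratio ?oner_neq0 ?mul1r ?mulr1 ?reprK ?denom_ratioP.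
Qed.

(** The denominators of x form a nonzero ideal, which lies in no nonzero prime
and so contains 1. *)
Lemma integral_of_locally x : dedekind A ->
  (forall p, nzprime p -> locally_integral p x) -> exists a, x = tofrac a.
Proof.
move=> hA loc; pose I s := exists b, tofrac s * x = tofrac b.
have hI : ideal I.
  split; first by exists 0; rewrite tofrac0 mul0r.
  move=> a u v [b e] [c f]; exists (a * b + c).
  by rewrite !tofracD !tofracM mulrDl -mulrA e f.
have [[a]|I1] := lem (I 1); first by rewrite tofrac1 mul1r => ->; exists a.
have [|p hp sIp] := nzprime_above hA hI I1.
  by have [d d0 hd] := fraction_denominator x; exists d.
by have [s [b [ps e]]] := loc p hp; case: ps; apply: sIp; exists b.
Qed.

End LocalIntegrality.

(** * p-orderings and universality *)

Section Orderings.
Variable A : idomainType.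
Implicit Types (p q : A -> Prop) (s E : seq A).

(** The list is read from its end: the head is the last element chosen. *)
Fixpoint p_ordering p s : Prop :=
  if s is x :: s' then p_ordering p s' /\
    forall y, ldvd p (\prod_(a <- s') (x - a)) (\prod_(a <- s') (y - a))
  else True.

(** Split off the Newton term: P = Q + C * M, where M is the monic polynomial
with roots in s, and C is chosen to lower the degree of Q.  Q agrees with P on
s, so it is locally integral by induction; then C * M is locally integral at
x, and by the minimality of x it is so everywhere. *)
Lemma p_ordering_interpolation p s (P : {poly {fraction A}}) : nzprime p ->
  p_ordering p s -> (size P <= size s)%N ->
  (forall a, a \in s -> locally_integral p P.[tofrac a]) ->
  forall y, locally_integral p P.[tofrac y].
Proof.
move=> hp; elim: s P => [|x s IH] P /=.
  move=> _; rewrite leqn0 size_poly_eq0 => /eqP -> _ y.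
  have [_ p1 _ _] := hp; exists 1, 0; split=> //.
  by rewrite horner0 mulr0 tofrac0.
move=> [os ox] sP hP y.
pose M : {poly {fraction A}} := \prod_(a <- s) ('X - (tofrac a)%:P).
have evM z : M.[tofrac z] = tofrac (\prod_(a <- s) (z - a)).
  rewrite /M horner_prod rmorph_prod /=; apply: eq_bigr => a _.
  by rewrite hornerXsubC tofracB.
have sM : size M = (size s).+1 by rewrite size_prod_XsubC.
pose C := P`_(size s); pose Q := P - C *: M.
have hQ z : P.[tofrac z] = Q.[tofrac z] + C * tofrac (\prod_(a <- s) (z - a)).
  by rewrite /Q hornerD hornerN hornerZ evM subrK.
have sQ : (size Q <= size s)%N.
  apply/leq_sizeP => j; rewrite leq_eqVlt coefB coefZ => /orP[/eqP <-|js].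
    have -> : M`_(size s) = 1.
      have /monicP := monic_prod_XsubC s xpredT (@tofrac A).
      by rewrite lead_coefE sM.
    by rewrite mulr1 subrr.
  by rewrite !nth_default ?mulr0 ?subr0 ?sM // (leq_trans sP).
have Qs a : a \in s -> locally_integral p Q.[tofrac a].
  move=> sa; have := hP a; rewrite inE sa orbT hQ => /(_ isT).
  rewrite (_ : \prod_(b <- s) (a - b) = 0) ?tofrac0 ?mulr0 ?addr0 //.
  by rewrite (big_rem a) //= subrr mul0r.
have Qint := IH Q os sQ Qs.
rewrite hQ; apply: locally_integralD => //.
apply: (locally_integral_ldvd hp (ox y)).
have -> : C * tofrac (\prod_(a <- s) (x - a)) = P.[tofrac x] - Q.[tofrac x].
  by rewrite hQ addrC addKr.
by apply: locally_integralB => //; apply: hP; rewrite mem_head.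
Qed.

(** Choose x with the ideal of local multiples of its product as large as
possible; in a valuation ring, maximal means largest. *)
Lemma p_ordering_next p s : dedekind A -> nzprime p ->
  exists x, forall y, ldvd p (\prod_(a <- s) (x - a)) (\prod_(a <- s) (y - a)).
Proof.
move=> hA hp; have [hN _ _] := hA.
have [||x [_ hx]] := @noether_max A A
    (fun x => ldvd p (\prod_(a <- s) (x - a))) (fun=> True) hN.
- by move=> x; apply: ldvd_ideal.
- by exists 0.
exists x => y.
have [//|xy] := ldvd_total (\prod_(a <- s) (x - a)) (\prod_(a <- s) (y - a)) hA hp.
apply: (hx y) => //; last exact: ldvd_refl.
by move=> z; apply: ldvd_trans.
Qed.

(** All the products of differences are local units. *)
Lemma p_ordering_distinct_residues p s : nzprime p -> uniq s ->
  (forall a b, a \in s -> b \in s -> a != b -> ~ p (a - b)) -> p_ordering p s.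
Proof.
move=> hp; elim: s => //= x s IH /andP[xs us] hs; split.
  by apply: IH => // a b sa sb; apply: hs; rewrite inE ?sa ?sb orbT.
move=> y; apply: ldvd_unit.
have : forall b, b \in s -> ~ p (x - b).
  move=> b sb; apply: hs; rewrite ?mem_head ?inE ?sb ?orbT //.
  by apply: contraNneq xs => ->.
elim: {IH hs xs us} s => [|b s IH] hs; first by rewrite big_nil; case: hp.
rewrite big_cons; apply: nzprimeNM => //; first by apply: hs; rewrite mem_head.
by apply: IH => c sc; apply: hs; rewrite inE sc orbT.
Qed.

(** The invariant of the construction: one spare element beyond the n + 1 of
a p-ordering, which may be a different one for each p. *)
Definition locally_rich n E := [/\ uniq E, size E = n.+2 &
  forall p, nzprime p ->
    exists s, [/\ size s = n.+1, {subset s <= E} & p_ordering p s]].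

Lemma locally_rich_universal n E : dedekind A -> locally_rich n E ->
  universal n [fset x in E]%fset.
Proof.
move=> hA [_ _ rich] P sP; split=> [h a _|h y _]; first exact: h.
apply: integral_of_locally => // p hp.
have [s [ss sE os]] := rich p hp.
apply: (p_ordering_interpolation hp os); first by rewrite ss.
move=> a /sE Ea; have [|b ->] := h a; first by rewrite !inE.
by have [_ p1 _ _] := hp; exists 1, b; rewrite tofrac1 mul1r.
Qed.

End Orderings.

(** * The Chinese remainder theorem for local conditions *)

Section Approximation.
Variable A : idomainType.
Implicit Types (p q : A -> Prop) (L : seq (A -> Prop)).

Definition add_ideal (I J : A -> Prop) z := exists u v, [/\ I u, J v & z = u + v].

Lemma add_ideal_ideal (I J : A -> Prop) :
  ideal I -> ideal J -> ideal (add_ideal I J).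
Proof.
move=> hI hJ; split.
  by exists 0, 0; rewrite addr0; split=> //; [case: hI|case: hJ].
move=> a _ _ [u [v [Iu Jv ->]]] [w [x [Iw Jx ->]]].
exists (a * u + w), (a * v + x); split; [exact: hI.2|exact: hJ.2|ring].
Qed.

Lemma nzprime_comaximal p q : dedekind A -> nzprime p -> nzprime q -> p <> q ->
  add_ideal p q 1.
Proof.
move=> hA hp hq; apply: contra_notP => h1.
have [[ip _ _ _] [iq _ _ _]] := (hp, hq).
have hI := add_ideal_ideal ip iq.
have <- : add_ideal p q = p.
  apply: (nzprime_maximal hA) => // u pu; exists u, 0; rewrite addr0.
  by split=> //; case: iq.
apply: (nzprime_maximal hA) => // u pu; exists 0, u; rewrite add0r.
by split=> //; case: ip.
Qed.

(** Each term of the binomial expansion of 1 = (a + b) ^ (m + n) lies in I or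
in J. *)
Lemma comaximal_powers (I J : A -> Prop) a b m n : ideal I -> ideal J ->
  I (a ^+ m) -> J (b ^+ n) -> a + b = 1 -> add_ideal I J 1.
Proof.
move=> hI hJ Ia Jb ab; have hIJ := add_ideal_ideal hI hJ.
rewrite -(expr1n _ (m + n)) -ab exprDn; apply: ideal_sum => // i.
rewrite -mulr_natl; apply: idealM => //.
have [ni|ni] := leqP n i.
  exists 0, (a ^+ (m + n - i) * b ^+ i).
  rewrite add0r; split=> //; first by case: hI.
  by apply: idealM => //; rewrite -(subnK ni) exprD; apply: idealM.
exists (a ^+ (m + n - i) * b ^+ i), 0.
rewrite addr0; split=> //; last by case: hJ.
by rewrite -addnBA ?(ltnW ni) // exprD -mulrA mulrC; apply: idealM.
Qed.

(** Dimension one: p is the only nonzero prime inside p.  Otherwise a prime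
containing c and avoiding all s * a ^ n with s outside p would be a nonzero
prime inside p that misses a, whereas it equals p by maximality. *)
Lemma ldvd_pow p c a : dedekind A -> nzprime p -> c != 0 -> p a ->
  exists n, ldvd p c (a ^+ n).
Proof.
move=> hA hp c0 pa; have [hN _ _] := hA; have [ip p1 _ _] := hp.
apply: contrapT => none.
have [|||P [iP sP dP pP]] := @prime_avoiding A
    (fun x => exists s n, ~ p s /\ x = s * a ^+ n)
    (fun x => exists w, x = w * c) hN.
- move=> _ _ [s [m [ps ->]]] [t [n [pt ->]]]; exists (s * t), (m + n)%N.
  by split; [exact: nzprimeNM|rewrite exprD; ring].
- split; first by exists 0; rewrite mul0r.
  by move=> b _ _ [u ->] [v ->]; exists (b * u + v); ring.
- move=> _ [w ->] [s [n [ps e]]]; apply: none; exists n, s, w.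
  by rewrite e.
have hP : nzprime P.
  split=> //; first by move/dP; apply; exists 1, 0%N; rewrite expr0 mulr1.
  by exists c => //; apply: sP; exists 1; rewrite mul1r.
have eP : p = P.
  apply: (nzprime_maximal hA hP ip p1) => x Px; apply: contrapT => px.
  by apply: (dP x Px); exists x, 0%N; rewrite expr0 mulr1.
by apply: (dP a); [rewrite -eP|exists 1, 1%N; rewrite expr1 mul1r].
Qed.

Lemma local_comaximal p q b c : dedekind A -> nzprime p -> nzprime q -> p <> q ->
  b != 0 -> c != 0 -> add_ideal (ldvd p b) (ldvd q c) 1.
Proof.
move=> hA hp hq npq b0 c0.
have [u [v [pu qv e]]] := nzprime_comaximal hA hp hq npq.
have [m hm] := ldvd_pow hA hp b0 pu; have [n hn] := ldvd_pow hA hq c0 qv.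
exact: comaximal_powers (ldvd_ideal b hp) (ldvd_ideal c hq) hm hn (esym e).
Qed.

(** The product of the elements that separate p from each prime of L. *)
Lemma separating_element p b L (m : (A -> Prop) -> A) : dedekind A ->
  nzprime p -> b != 0 ->
  (forall q, q \in L -> [/\ nzprime q, q <> p & m q != 0]) ->
  exists e, ldvd p b (1 - e) /\ forall q, q \in L -> ldvd q (m q) e.
Proof.
move=> hA hp b0; elim: L => [|q L IH] hL.
  by exists 1; rewrite subrr; split=> //; case: (ldvd_ideal b hp).
have [|e [he hLe]] := IH; first by move=> r Lr; apply: hL; rewrite inE Lr orbT.
have [hq nqp mq0] := hL q (mem_head _ _).
have [u [v [pu qv euv]]] := local_comaximal hA hp hq (fun h => nqp (esym h)) b0 mq0.
exists (e * v); split.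
  have -> : 1 - e * v = e * u + (1 - e).
    have -> : v = 1 - u by rewrite euv addrC addKr.
    ring.
  by apply: (ldvd_ideal b hp).2.
move=> r; rewrite inE => /orP[/eqP ->|Lr].
  by apply: idealM => //; apply: ldvd_ideal.
rewrite mulrC; apply: idealM; last exact: hLe.
by apply: ldvd_ideal; have [] := hL r; rewrite ?inE ?Lr ?orbT.
Qed.

(** Correct an approximation x for the primes of L by a multiple of an element
that is locally small on L and close to 1 at the new prime p. *)
Lemma simultaneous_approximation L (m r : (A -> Prop) -> A) : dedekind A ->
  (forall p, p \in L -> nzprime p /\ m p != 0) ->
  exists x, forall p, p \in L -> ldvd p (m p) (x - r p).
Proof.
move=> hA; elim: L => [|p L IH] hL; first by exists 0.
have [|x hx] := IH; first by move=> q Lq; apply: hL; rewrite inE Lq orbT.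
have [pL|pL] := boolP (p \in L).
  by exists x => q; rewrite inE => /orP[/eqP ->|]; apply: hx.
have [hp mp0] := hL p (mem_head _ _).
have [|e [he hLe]] := @separating_element p (m p) L m hA hp mp0.
  move=> q Lq; have [|hq mq] := hL q; first by rewrite inE Lq orbT.
  by split=> // e; move: pL; rewrite -e Lq.
exists (x + e * (r p - x)) => q; rewrite inE => /orP[/eqP ->|Lq].
  have -> : x + e * (r p - x) - r p = (x - r p) * (1 - e) by ring.
  by apply: idealM => //; apply: ldvd_ideal.
have [|hq _] := hL q; first by rewrite inE Lq orbT.
have -> : x + e * (r p - x) - r q = (r p - x) * e + (x - r q) by ring.
by apply: (ldvd_ideal (m q) hq).2; [apply: hLe|apply: hx].
Qed.

(** The powers of a nonzero nonunit. *)
Lemma exists_injective_sequence : ~ is_field A ->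
  exists f : nat -> A, injective f.
Proof.
move=> nf; have [t [t0 tu]] : exists t : A, t != 0 /\ t \isn't a GRing.unit.
  apply: contrapT => none; apply: nf => t t0; apply: contrapT => /negP tu.
  by apply: none; exists t.
exists (fun i => t ^+ i).
suff lt i j : (i < j)%N -> t ^+ i <> t ^+ j.
  by move=> i j; have [/lt|/lt ne /esym|] := ltngtP i j.
move=> ij e; move: tu; rewrite -(subnK ij) addnS -addSn exprD in e.
move/negP; apply; apply/unitrP; exists (t ^+ (j - i.+1)).
have h : t * t ^+ (j - i.+1) = 1.
  by apply: (mulIf (expf_neq0 i t0)); rewrite mul1r [RHS]e exprS.
by rewrite mulrC h.
Qed.

Lemma injective_escapes (f : nat -> A) (E : seq A) : injective f ->
  exists n, f n \notin E.
Proof.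
move=> fi; apply: contrapT => none.
suff : (size (map f (iota 0 (size E).+1)) <= size E)%N.
  by rewrite size_map size_iota ltnn.
apply: uniq_leq_size; first by rewrite map_inj_uniq ?iota_uniq.
move=> _ /mapP[n _ ->]; apply: contrapT => /negP h; apply: none.
by exists n.
Qed.

End Approximation.

(** * Adjoining one element *)

Section Extension.
Variable A : idomainType.
Implicit Types (p q : A -> Prop) (s E : seq A).

Lemma prod_mem_prime p (F : A -> A) (P : pred A) s a : ideal p ->
  a \in s -> P a -> p (F a) -> p (\prod_(b <- s | P b) F b).
Proof.
move=> ip sa Pa pFa; rewrite (big_rem a) //= Pa mulrC.
exact: idealM.
Qed.

(** If b = c modulo p * c locally, then b is c times the local unit 1 + (an
element of p). *)
Lemma congruent_ldvd p t b c : nzprime p -> p t ->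
  ldvd p (t * c) (b - c) -> ldvd p b c.
Proof.
move=> hp pt [s [w [ps e]]]; have [ip _ _ _] := hp.
exists (s + w * t), s; split; last by rewrite mulrDl -mulrA -e; ring.
move=> pst; apply: ps; rewrite -[s](addrK (w * t)).
by apply: idealB => //; apply: idealM.
Qed.

Lemma prod_sub_congr (I : A -> Prop) x y s : ideal I -> I (x - y) ->
  I (\prod_(a <- s) (x - a) - \prod_(a <- s) (y - a)).
Proof.
move=> hI hxy; elim: s => [|a s IH]; first by rewrite !big_nil subrr; case: hI.
rewrite !big_cons.
set u := \prod_(_ <- _) _; set v := \prod_(_ <- _) _.
have -> : (x - a) * u - (y - a) * v = (x - a) * (u - v) + v * (x - y) by ring.
by apply: hI.2 => //; apply: idealM.
Qed.

(** With y a best continuation of s and t in p, take r = y and m equal to t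
times the product of the differences y - a: if x = y modulo m locally, the
products for x and for y differ by a local unit.  The product for y is
nonzero because it divides, locally, the product for an element outside s. *)
Lemma approximate_next p s : dedekind A -> ~ is_field A -> nzprime p ->
  p_ordering p s ->
  exists m r, m != 0 /\ forall x, ldvd p m (x - r) -> p_ordering p (x :: s).
Proof.
move=> hA nf hp os; have [y hy] := p_ordering_next s hA hp.
have [ip _ _ [t pt t0]] := hp.
exists (t * \prod_(a <- s) (y - a)), y; split.
  have [f fi] := exists_injective_sequence nf.
  have [n hn] := injective_escapes s fi.
  rewrite mulf_neq0 //; apply/eqP => y0.
  have [u [w [pu]]] := hy (f n); rewrite y0 mulr0 => /eqP.
  rewrite mulf_eq0 => /orP[/eqP u0|]; first by apply: pu; rewrite u0; case: ip.
  apply/negP; rewrite prodf_seq_neq0; apply/allP => a sa; apply/implyP => _.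
  by rewrite subr_eq0; apply: contraNneq hn => ->.
move=> x hx /=; split=> // z.
apply: ldvd_trans (hy z) => //.
apply: (congruent_ldvd hp pt).
by apply: prod_sub_congr => //; apply: ldvd_ideal.
Qed.

Lemma locally_rich_extend n E : dedekind A -> ~ is_field A ->
  locally_rich n E -> exists x, locally_rich n.+1 (x :: E).
Proof.
move=> hA nf [uE sE rich].
(* The primes that do not contain D see the elements of E as distinct residues. *)
pose D := \prod_(a <- E) \prod_(b <- E | a != b) (a - b).
have D0 : D != 0.
  rewrite prodf_seq_neq0; apply/allP => a _; apply/implyP => _.
  rewrite prodf_seq_neq0; apply/allP => b _; apply/implyP => ab.
  by rewrite subr_eq0.
have hI : ideal (fun x => exists w, x = w * D).
  split; first by exists 0; rewrite mul0r.
  by move=> a _ _ [u ->] [v ->]; exists (a * u + v); ring.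
have [|L0 hL0] := finite_primes_above hA hI.
  by exists D => //; exists 1; rewrite mul1r.
pose L := [seq p <- L0 | `[< nzprime p >]].
have hL p : nzprime p -> p D -> p \in L.
  move=> hp pD; rewrite mem_filter; apply/andP; split; first exact/asboolP.
  by apply: hL0 => // _ [w ->]; apply: idealM => //; case: hp.
have Lp p : p \in L -> nzprime p by rewrite mem_filter => /andP[/asboolP].
have data p : exists d : seq A * A * A, nzprime p ->
    [/\ size d.1.1 = n.+1, {subset d.1.1 <= E}, d.1.2 != 0
      & forall x, ldvd p d.1.2 (x - d.2) -> p_ordering p (x :: d.1.1)].
  have [hp|hp] := lem (nzprime p); last by exists ([::], 0, 0).
  have [s [ss sub os]] := rich p hp.
  have [m [r [m0 hm]]] := approximate_next hA nf hp os.
  by exists (s, m, r).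
have [d hd] := choice data.
have [|x hx] :=
    @simultaneous_approximation A L (fun p => (d p).1.2) (fun p => (d p).2) hA.
  by move=> p /Lp hp; split=> //; have [] := hd p hp.
(* Adding multiples of M preserves all the approximations, which allows x to
   be moved outside E. *)
pose M := \prod_(p <- L) (d p).1.2.
have M0 : M != 0.
  rewrite prodf_seq_neq0; apply/allP => p /Lp hp; apply/implyP => _.
  by have [] := hd p hp.
have [f fi] := exists_injective_sequence nf.
have [|k hk] := @injective_escapes A (fun i => f i * M + x) E.
  by move=> i j /addIr/(mulIf M0)/fi.
exists (f k * M + x); split; [by rewrite /= hk|by rewrite /= sE|].
move=> p hp; have [pD|pD] := lem (p D); last first.
  exists E; split=> //; first by move=> a Ea; rewrite inE Ea orbT.
  apply: p_ordering_distinct_residues => // a b Ea Eb ab pab; apply: pD.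
  have [ip _ _ _] := hp.
  apply: (prod_mem_prime (a := a)) => //.
  by apply: (prod_mem_prime (a := b)) => //.
have pL := hL p hp pD; have [ss sub _ hm] := hd p hp.
exists (f k * M + x :: (d p).1.1); split; first by rewrite /= ss.
  by move=> a; rewrite !inE => /orP[->//|/sub ->]; rewrite orbT.
apply: hm; rewrite -addrA; apply: (ldvd_ideal _ hp).2; last exact: hx.
rewrite /M (big_rem p) //= mulrC; apply: idealM; first exact: ldvd_ideal.
exact: ldvd_refl.
Qed.

Lemma locally_rich_base : locally_rich 0 [:: 1; 0 : A].
Proof.
split=> //; first by rewrite /= inE oner_neq0.
move=> p [_ p1 _ _]; exists [:: 0]; split=> //=.
  by move=> a; rewrite !inE => ->; rewrite orbT.
by split=> // y; rewrite !big_nil; exists 1, 1.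
Qed.

End Extension.

Theorem theorem4p1 (A : idomainType) (hA : dedekind A) (hnf : ~ is_field A) :
  (forall n : nat, exists E : {fset A}, universal n E /\ #|` E|%fset = n.+2) /\
  (exists E : nat -> {fset A},
     (forall n : nat, (E n `<=` E n.+1)%fset) /\
     (forall n : nat, universal n (E n) /\ #|` E n|%fset = n.+2)).
Proof.
(* The choice function must be total, hence the vacuous case outside the
   invariant. *)
have step (nE : nat * seq A) : exists x,
    locally_rich nE.1 nE.2 -> locally_rich nE.1.+1 (x :: nE.2).
  have [r|r] := lem (locally_rich nE.1 nE.2); last by exists 0.
  by have [x hx] := locally_rich_extend hA hnf r; exists x.
have [f hf] := choice step.
pose s := fix s n := if n is m.+1 then f (m, s m) :: s m else [:: 1; 0 : A].
have rich n : locally_rich n (s n).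
  by elim: n => [|n IH]; [apply: locally_rich_base|apply: (hf (n, s n))].
pose E n := [fset x in s n]%fset.
have EP n : universal n (E n) /\ #|` E n|%fset = n.+2.
  split; first exact: locally_rich_universal.
  by have [us ss _] := rich n; rewrite card_fseq undup_id.
split; first by move=> n; exists (E n).
exists E; split=> // n; apply/fsubsetP => x.
by rewrite !inE => h; rewrite h orbT.
Qed.
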